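(* Assume $|B|<m$ and $A\not\subseteq B$, and let $\mathcal S_3=\{(w_1+uw_2,w_3)\in\mathcal R^m: w_1\in\Delta_A,\ w_2\in\Delta_B^c,\ w_3\in\Delta_C\}$. Then $\Phi(\mathscr C_{\mathcal S_3})$ is a linear code over $\mathbb F_q$ with parameters $\big[2q^{|A|+|C|}(q^m-q^{|B|}),\ m+|A|+|C|,\ 2(q-1)q^{|A|+|C|-1}(q^m-q^{|B|})\big]$ and nonzero Hamming weights: $2(q-1)q^{|A|+|C|-1}(q^m-q^{|B|})$ with frequency $q^{m+|A|+|C|}-2q^{m-|B|}+q^{m-|A\cup B|}$; $(q-1)q^{|A|+|C|-1}(2q^m-q^{|B|})$ with frequency $2(q^{m-|B|}-q^{m-|A\cup B|})$; $2(q-1)q^{m+|A|+|C|-1}$ with frequency $q^{m-|A\cup B|}-1$. Furthermore, $\Phi(\mathscr C_{\mathcal S_3})$ is minimal, near-Griesmer and distance-optimal; it is self-orthogonal if $q\in\{2,3\}$; and it is a $2$-weight code if $A\cup B=[m]$ and a $3$-weight code otherwise.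
   Context: Let $q$ be a prime power, $\mathbb F_q$ the field of order $q$, $m\ge 2$ an integer and $[m]=\{1,\dots,m\}$. For $v\in\mathbb F_q^m$, $\mathrm{supp}(v)=\{i:v_i\ne0\}$. For nonempty $P\subseteq[m]$, $\Delta_P=\{v\in\mathbb F_q^m:\mathrm{supp}(v)\subseteq P\}$, $\Delta_P^c=\mathbb F_q^m\setminus\Delta_P$. $A,B,C$ denote nonempty subsets of $[m]$. Let $R=\mathbb F_q[u]/\langle u^2\rangle$ and $\mathcal R=R\times\mathbb F_q$; each element of $\mathcal R^m$ is uniquely $(d+ue,f)$ with $d,e,f\in\mathbb F_q^m$. Define $\langle(d_1+ue_1,f_1),(d_2+ue_2,f_2)\rangle=(d_1+ue_1)\cdot(d_2+ue_2)+u\,f_1\cdot f_2\in R$, where $x\cdot y=\sum_i x_iy_i$. For a nonempty $\mathcal D\subseteq\mathcal R^m$ listed in a fixed order, $\mathscr C_{\mathcal D}=\{(\langle r,s\rangle)_{s\in\mathcal D}: r\in\mathcal R^m\}\subseteq R^{|\mathcal D|}$. The Gray map $\Phi:R^n\to\mathbb F_q^{2n}$ is $\Phi(d+ue)=(e,d+e)$, applied to codes elementwise. An $[n,k,d]$ code is a linear code over $\mathbb F_q$ of length $n$, dimension $k$, minimum Hamming distance $d$. It is distance-optimal if no linear $[n,k,d+1]$ code over $\mathbb F_q$ exists; near-Griesmer if $\sum_{i=0}^{k-1}\lceil d/q^i\rceil=n-1$; minimal if whenever $\mathrm{supp}(c')\subseteq\mathrm{supp}(c)$ for codewords $c,c'$,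 then $c'=\alpha c$ for some $\alpha\in\mathbb F_q$; self-orthogonal if $\mathcal C\subseteq\mathcal C^\perp$ (Euclidean). *)

(* Defs.v *)
From HB Require Import structures.
From mathcomp Require Import all_boot all_order all_algebra all_field.
Set Implicit Arguments. Unset Strict Implicit. Unset Printing Implicit Defensive.
Import GRing.Theory.
Local Open Scope ring_scope.

Section Defs.
Variable F : finFieldType.

Definition supp m (v : 'rV[F]_m) : {set 'I_m} := [set i | v 0 i != 0].
Definition Delta m (P : {set 'I_m}) : {set 'rV[F]_m} :=
  [set v | supp v \subset P].
Definition dotF m (x y : 'rV[F]_m) : F := \sum_i x 0 i * y 0 i.

(* R = F[u]/<u^2>: the pair (a, b) encodes a + u b *)
Definition Radd (x y : F * F) : F * F := (x.1 + y.1, x.2 + y.2).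
Definition Rmul (x y : F * F) : F * F := (x.1 * y.1, x.1 * y.2 + x.2 * y.1).
Definition Ru (t : F) : F * F := (0, t).

(* elements of (R x F_q)^m : (d + u e, f) encoded as ((d, e), f) *)
Definition calR m := ('rV[F]_m * 'rV[F]_m * 'rV[F]_m)%type.

Definition Rdot m (d1 e1 d2 e2 : 'rV[F]_m) : F * F :=
  \big[Radd/(0, 0)]_(i < m) Rmul (d1 0 i, e1 0 i) (d2 0 i, e2 0 i).

Definition pairing m (r s : calR m) : F * F :=
  Radd (Rdot r.1.1 r.1.2 s.1.1 s.1.2) (Ru (dotF r.2 s.2)).

Definition Gray n (c : 'I_n -> F * F) : 'rV[F]_(n + n) :=
  row_mx (\row_j (c j).2) (\row_j ((c j).1 + (c j).2)).

Definition GrayCode m (D : {set calR m}) : {set 'rV[F]_(#|D| + #|D|)} :=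
  [set Gray (fun j => pairing r (enum_val j)) | r : calR m].

Definition wt N (x : 'rV[F]_N) : nat := #|supp x|.

Definition is_code_kd N (V : {vspace 'rV[F]_N}) (k d : nat) : Prop :=
  [/\ \dim V = k,
      exists2 c, c \in V & (c != 0) && (wt c == d)
    & forall c, c \in V -> c != 0 -> (d <= wt c)%N].

Definition distance_optimal N (V : {vspace 'rV[F]_N}) (k d : nat) : Prop :=
  ~ exists V' : {vspace 'rV[F]_N}, is_code_kd V' k d.+1.

Definition ceil_div (a b : nat) : nat := ((a + b.-1) %/ b)%N.

Definition near_griesmer N (k d : nat) : Prop :=
  (\sum_(i < k) ceil_div d (#|F| ^ i))%N = N.-1.

Definition minimal_code N (V : {vspace 'rV[F]_N}) : Prop :=
  forall c c', c \in V -> c' \in V -> supp c' \subset supp c ->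
    exists a : F, c' = a *: c.

Definition self_orthogonal N (V : {vspace 'rV[F]_N}) : Prop :=
  forall x y, x \in V -> y \in V -> dotF x y = 0.

Definition weights N (V : {vspace 'rV[F]_N}) : seq nat :=
  undup [seq wt c | c <- enum [pred c : 'rV[F]_N | (c \in V) && (c != 0)]].

Definition freq N (V : {vspace 'rV[F]_N}) (w : nat) : nat :=
  #|[pred c : 'rV[F]_N | (c \in V) && (wt c == w)]|.

Definition S3 m (A B C : {set 'I_m}) : {set calR m} :=
  [set r : calR m | [&& r.1.1 \in Delta A, r.1.2 \notin Delta B & r.2 \in Delta C]].

End Defs.

(* Main.v *)
Require Import Defs.
From HB Require Import structures.
From mathcomp Require Import all_boot all_order all_algebra all_field.
From mathcomp Require Import zify ring.
Set Implicit Arguments. Unset Strict Implicit. Unset Printing Implicit Defensive.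
Import GRing.Theory.
Local Open Scope ring_scope.

(** A codeword is a pair of linear forms, [lform r] and [lform (twist r)],
evaluated on [S3], which is the difference of the two boxes
Delta_A x F^m x Delta_C and Delta_A x Delta_B x Delta_C.  A linear form that
does not vanish on a subspace is nonzero on exactly (q - 1) / q of it, so every
weight depends only on which of the two boxes the two forms annihilate.
Restricting [r] to F^m x Delta_A x Delta_C makes the encoding injective, and
counting there gives the dimension and the frequencies.  Minimality is the
Ashikhmin-Barg criterion.  Optimality is the Griesmer bound: for w1 the Griesmer
sum is one less than the length, and replacing w1 by w1 + 1 increases it by at
least |A| + |B| + |C| >= 3.  For q = 2 (resp. 3) all weights are divisible by
4 (resp. 3), which forces self-orthogonality. *)

(** * Ceiling division *)

Lemma leq_ceil_div a b c : (0 < b)%N -> (ceil_div a b <= c)%N = (a <= b * c)%N.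
Proof.
case: b => // b _; rewrite /ceil_div -ltnS ltn_divLR //= mulSn mulnC; lia.
Qed.

Lemma ceil_div_eq a b c :
  (0 < b)%N -> (a <= b * c)%N -> (b * c < a + b)%N -> ceil_div a b = c.
Proof.
move=> b0 le_a lt_a; apply/eqP; rewrite eqn_leq leq_ceil_div // le_a /=.
case: c lt_a {le_a} => // c lt_a; rewrite ltnNge leq_ceil_div // -ltnNge.
by rewrite mulnS in lt_a; lia.
Qed.

(** By [leq_ceil_div] a ceiling is determined by its upper bounds, and both sides have the same
    ones. This lets a Griesmer sum be computed by repeated division by q. *)
Lemma ceil_div_mul a b c :
  (0 < b)%N -> (0 < c)%N -> ceil_div (ceil_div a b) c = ceil_div a (b * c).
Proof.
move=> b0 c0; have bc0 : (0 < b * c)%N by rewrite muln_gt0 b0.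
apply/eqP; rewrite eqn_leq; apply/andP; split.
  by rewrite !leq_ceil_div // mulnA -leq_ceil_div.
by rewrite leq_ceil_div // -mulnA -!leq_ceil_div.
Qed.

Lemma leq_ceil_div2r a a' b :
  (0 < b)%N -> (a <= a')%N -> (ceil_div a b <= ceil_div a' b)%N.
Proof.
by move=> b0 le_a; rewrite leq_ceil_div // (leq_trans le_a) // -leq_ceil_div.
Qed.

(** * Griesmer sums of the distances that occur *)

Section Griesmer_sum.
Variable q : nat.
Hypothesis q_gt1 : (1 < q)%N.
Let q_gt0 : (0 < q)%N := ltnW q_gt1.

Definition griesmer_sum k d := (\sum_(i < k) ceil_div d (q ^ i))%N.

(** Splits off the term i = 0; what remains is the sum for a residual code, of dimension k and
    distance at least the ceiling of d / q. *)
Lemma griesmer_sumS k d :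
  griesmer_sum k.+1 d = (d + griesmer_sum k (ceil_div d q))%N.
Proof.
rewrite /griesmer_sum big_ord_recl expn0 {1}/ceil_div addn0 divn1; congr addn.
by apply: eq_bigr => i _; rewrite ceil_div_mul ?expn_gt0 ?q_gt0 // -expnS.
Qed.

Lemma leq_griesmer_sum k d d' :
  (d <= d')%N -> (griesmer_sum k d <= griesmer_sum k d')%N.
Proof.
by move=> le_d; apply: leq_sum => i _; rewrite leq_ceil_div2r ?expn_gt0 ?q_gt0.
Qed.

(** These are the parameters of 2(q - 1) copies of the simplex code of dimension s + 1, which meets
    the Griesmer bound; every division is exact. *)
Lemma griesmer_sum_simplex s :
  griesmer_sum s.+1 (2 * (q - 1) * q ^ s) = (2 * (q ^ s.+1 - 1))%N.
Proof.
elim: s => [|s IHs]; rewrite griesmer_sumS.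
  by rewrite /griesmer_sum big_ord0 expn0 expn1; lia.
rewrite (@ceil_div_eq _ _ (2 * (q - 1) * q ^ s)) ?IHs ?expnS //; nia.
Qed.

(** Lowering the distance by one affects only the first term, since the next ceiling rounds back up
    to 2(q - 1)q^(s-1). *)
Lemma griesmer_sum_simplex_pred s :
  griesmer_sum s.+1 (2 * (q - 1) * q ^ s - 1) = (2 * (q ^ s.+1 - 1) - 1)%N.
Proof.
have qs := expn_gt0 q s; rewrite q_gt0 /= in qs.
case: s qs => [|s] qs; rewrite griesmer_sumS.
  by rewrite /griesmer_sum big_ord0 expn0 expn1; lia.
have qs' := expn_gt0 q s; rewrite q_gt0 /= in qs'.
rewrite (@ceil_div_eq _ _ (2 * (q - 1) * q ^ s)) ?expnS //; try nia.
rewrite griesmer_sum_simplex expnS; nia.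
Qed.

(** The distance w1 in the form suited to division by q: s is m - |B|, and T = |A| + |B| + |C| - 1
    is the number of divisions that cancel a common factor q of both powers. *)
Definition dual_distance s T := (2 * (q - 1) * (q ^ (s + T) - q ^ T))%N.

Lemma ceil_dual_distance s T :
  ceil_div (dual_distance s T.+1) q = dual_distance s T.
Proof.
rewrite /dual_distance addnS !expnS -mulnBr mulnCA.
by apply: ceil_div_eq; lia.
Qed.

(** A multiple of q plus one rounds up to the quotient plus one, so an increment of the distance
    survives each exact division. *)
Lemma ceil_dual_distance_succ s T :
  ceil_div (dual_distance s T.+1).+1 q = (dual_distance s T).+1.
Proof.
rewrite /dual_distance addnS !expnS -mulnBr mulnCA.
by apply: ceil_div_eq => //; rewrite mulnS; lia.
Qed.

(** The first inexact division: 2(q - 1)/q lies in [1, 2), so exactly one is lost. This is the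
    source of the defect one in the near-Griesmer property. *)
Lemma ceil_dual_distance0 s :
  ceil_div (dual_distance s.+1 0) q = (2 * (q - 1) * q ^ s - 1)%N.
Proof.
have qs := expn_gt0 q s; rewrite q_gt0 /= in qs.
rewrite /dual_distance addn0 !expnS expn0.
by apply: ceil_div_eq => //; nia.
Qed.

(** T exact divisions lead to T = 0, where one inexact division leaves
    [griesmer_sum_simplex_pred]. *)
Lemma griesmer_sum_dual s T :
  griesmer_sum (s.+1 + T.+1) (dual_distance s.+1 T)
    = (2 * (q ^ (s.+1 + T.+1) - q ^ T.+1) - 1)%N.
Proof.
elim: T => [|T IHT].
  rewrite addn1 griesmer_sumS ceil_dual_distance0 griesmer_sum_simplex_pred.
  rewrite /dual_distance addn0 !expnS expn0.
  have qs := expn_gt0 q s; rewrite q_gt0 /= in qs; nia.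
rewrite addnS griesmer_sumS ceil_dual_distance IHT /dual_distance addnS.
rewrite [(q ^ (s.+1 + T).+2)%N]expnS [(q ^ T.+2)%N]expnS.
have qT : (q ^ T.+1 < q ^ (s.+1 + T).+1)%N by rewrite ltn_exp2l //; lia.
by nia.
Qed.

(** Each of the first T + 1 terms grows by one, and the later ones do not decrease. *)
Lemma griesmer_sum_dual_succ s T :
  (griesmer_sum (s.+1 + T.+1) (dual_distance s.+1 T) + T.+1
    <= griesmer_sum (s.+1 + T.+1) (dual_distance s.+1 T).+1)%N.
Proof.
elim: T => [|T IHT].
  rewrite !addn1 (griesmer_sumS s.+1) (griesmer_sumS s.+1) -addSn leq_add2l.
  exact: leq_griesmer_sum (leq_ceil_div2r q_gt0 (leqnSn _)).
rewrite (addnS s.+1) !(griesmer_sumS (s.+1 + T.+1)%N) ceil_dual_distance ceil_dual_distance_succ; lia.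
Qed.

End Griesmer_sum.

(** * The Griesmer bound and a criterion for minimality *)

Section Codes.
Variable F : finFieldType.
Local Notation q := #|F|.

Lemma card_setI_sum (T : finType) (X S : {set T}) :
  #|X :&: S| = (\sum_(i in S) (i \in X))%N.
Proof.
rewrite -sum1_card (eq_bigl [pred i | (i \in X) && (i \in S)]) => [|i].
  by rewrite big_mkcondl; apply: eq_bigr => i _; case: (i \in X).
by rewrite /= inE.
Qed.

Lemma sum_card_const n : (\sum_(t : F) n = q * n)%N.
Proof. by rewrite sum_nat_const. Qed.

(* A coordinate outside [supp c] is unaffected by [t]; on [supp c] exactly one
   value of [t] makes it vanish. *)
Lemma sum_card_supp_line N (S : {set 'I_N}) (c v : 'rV[F]_N) :
  (\sum_(t : F) #|supp (v - t *: c) :&: S|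
    = q * #|supp v :&: (S :\: supp c)| + (q - 1) * #|supp c :&: S|)%N.
Proof.
under eq_bigr do rewrite card_setI_sum.
rewrite exchange_big /= !card_setI_sum !big_distrr /= [X in (X + _)%N]big_mkcond /=.
rewrite [X in (_ + X)%N]big_mkcond [LHS]big_mkcond -big_split /=.
apply: eq_bigr => i _; rewrite !inE.
case: (i \in S); rewrite ?andbF // andbT.
have [ci0 | ci0] /= := eqVneq (c 0 i) 0.
  under eq_bigr do rewrite !inE !mxE ci0 mulr0 subr0.
  by rewrite sum_nat_const muln0 addn0.
under eq_bigr do rewrite !inE !mxE.
rewrite muln1 add0n (bigD1 (v 0 i / c 0 i)) //= divfK // subrr eqxx add0n.
rewrite (eq_bigr (fun=> 1%N)) => [|t tN].
  by rewrite sum1_card cardC1 subn1.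
rewrite subr_eq0; suff -> : v 0 i != t * c 0 i by [].
by apply: contraNneq tN => ->; rewrite mulfK.
Qed.

(* Induction on the dimension through the residual code, which is realised here
   by shrinking the set [S] of coordinates that are counted. *)
Lemma griesmer_bound N k d (S : {set 'I_N}) (V : {vspace 'rV[F]_N}) :
  \dim V = k ->
  (forall c, c \in V -> c != 0 -> (d <= #|supp c :&: S|)%N) ->
  (griesmer_sum q k d <= #|S|)%N.
Proof.
have q1 := finNzRing_gt1 F; have q0 := ltnW q1.
elim: k d S V => [|k IHk] d S V dimV wtV; first by rewrite /griesmer_sum big_ord0.
rewrite griesmer_sumS //.
have: vpick V != 0 by rewrite vpick0 -dimv_eq0 dimV.
have := memv_pick V; move: (vpick V) => c0 c0V c0N.
have c0P : (c0 \in V) && (c0 != 0) by rewrite c0V.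
case: (@arg_minnP _ c0 (fun c => (c \in V) && (c != 0))
  (fun c => #|supp c :&: S|) c0P) => c /andP[cV cN] cmin.
have dc := wtV c cV cN.
(* A complement of the line of a codeword c of least weight on S. Counted on S minus [supp c], it
   plays the role of the residual code. *)
pose V' := (V :\: <[c]>)%VS.
have dimV' : \dim V' = k.
  apply/eqP; rewrite -eqSS -dimV -(dimv_cap_compl V <[c]>) (capv_idPr _) -?memvE //.
  by rewrite dim_vline cN add1n.
suff: (griesmer_sum q k (ceil_div d q) <= #|S :\: supp c|)%N.
  by have := cardsID (supp c) S; rewrite setIC; lia.
apply: (IHk _ _ V') => // v vV' vN.
have vV : v \in V by rewrite (subvP (diffvSl V <[c]>)).
rewrite leq_ceil_div //.
(* No v - t c is zero, as v lies outside the line of c, so each weighs at least as much as c on S.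
   Summing over t, q times the weight of v off [supp c] is at least the weight of c. *)
have : (\sum_(t : F) #|supp c :&: S| <= \sum_(t : F) #|supp (v - t *: c) :&: S|)%N.
  apply: leq_sum => t _; apply: cmin; rewrite rpredB ?rpredZ //=.
  apply: contraNneq vN => /eqP; rewrite subr_eq0 => /eqP v_tc.
  rewrite -memv0 -(capv_diff V <[c]>) memv_cap vV' v_tc rpredZ //=.
  exact: memv_line.
rewrite sum_card_supp_line sum_card_const.
move: q1 dc; move: q #|supp c :&: S| #|supp v :&: _|; clear; nia.
Qed.

(* The Ashikhmin-Barg criterion *)
Lemma minimal_code_bound N (V : {vspace 'rV[F]_N}) wmin wmax :
  (forall c, c \in V -> c != 0 -> (wmin <= wt c <= wmax)%N) ->
  ((q - 1) * wmax < q * wmin)%N -> minimal_code V.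
Proof.
have q1 := finNzRing_gt1 F.
move=> wtV ratio c c' cV c'V sub.
have [->|c'N] := eqVneq c' 0; first by exists 0; rewrite scale0r.
have [/existsP[t /eqP v_tc] | /existsPn indep] :=
  boolP [exists t : F, c == t *: c'].
  have [t0 | tN] := eqVneq t 0; last by exists t^-1; rewrite v_tc scalerK.
  move: sub; rewrite v_tc t0 scale0r => /subsetP sub.
  exists 0; rewrite scaler0; apply/rowP => i; rewrite mxE; apply/eqP.
  by apply: contraT => c'i; have := sub i; rewrite !inE mxE eqxx => /(_ c'i).
(* The term t = 0 is [wt c]; the other q - 1 vectors are nonzero codewords. As [supp c'] lies in
   [supp c], the exact value of the sum is q (wt c - wt c') + (q - 1) wt c', whence q wmin <= (q -
   1) wmax, a contradiction. *)
have: (wt c + (q - 1) * wmin <= \sum_(t : F) #|supp (c - t *: c') :&: setT|)%N.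
  rewrite (bigD1 (0 : F)) //= scale0r subr0 setIT leq_add2l subn1.
  rewrite -(cardC1 (0 : F)) -sum_nat_const; apply: leq_sum => t _; rewrite setIT.
  have := wtV (c - t *: c'); rewrite rpredB ?rpredZ // subr_eq0 indep.
  by case/(_ isT isT)/andP.
rewrite sum_card_supp_line setIT setTD -setDE cardsD.
rewrite (setIidPr sub); have := subset_leq_card sub.
have cN : c != 0 by have := indep 0; rewrite scale0r.
have /andP[_ lec] := wtV c cV cN.
have /andP[gec' _] := wtV c' c'V c'N.
move: q1 ratio lec gec'; rewrite /wt; move: q #|supp c| #|supp c'|; clear; nia.
Qed.

End Codes.

(** * Coordinate subspaces, boxes and linear forms on them *)

Section Box.
Variables (F : finFieldType) (m : nat).
Local Notation q := #|F|.
Local Notation V := 'rV[F]_m.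
Implicit Types (P E A B C : {set 'I_m}) (x y : V).

Lemma DeltaP P x : reflect (forall i, i \notin P -> x 0 i = 0) (x \in Delta F P).
Proof.
rewrite inE; apply: (iffP subsetP) => [sub i iP | x0 i].
  by apply/eqP; apply: contraNT iP => xi; apply: sub; rewrite inE.
by rewrite inE; apply: contraNT => iP; rewrite x0.
Qed.

(** [Delta F (~: P)] serves throughout as the orthogonal complement of [Delta F P]. *)
Lemma DeltaCP P x : reflect (forall i, i \in P -> x 0 i = 0) (x \in Delta F (~: P)).
Proof.
by apply: (iffP (DeltaP _ _)) => x0 i iP; apply: x0; rewrite ?inE ?negbK // in iP *.
Qed.

Lemma DeltaCPn P x : reflect (exists2 i, i \in P & x 0 i != 0) (x \notin Delta F (~: P)).
Proof.
apply: (iffP idP) => [xP | [i iP xi]].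
  suff /exists_inP[i iP xi] : [exists i in P, x 0 i != 0] by exists i.
  apply: contraNT xP => /exists_inPn x0; apply/DeltaCP => i iP.
  by apply/eqP; have := x0 i iP; rewrite negbK.
by apply: contraNN xi => /DeltaCP ->.
Qed.

Lemma Delta0 P : 0 \in Delta F P.
Proof. by apply/DeltaP => i _; rewrite mxE. Qed.

Lemma DeltaD P x y : x \in Delta F P -> y \in Delta F P -> x + y \in Delta F P.
Proof.
by move=> /DeltaP x0 /DeltaP y0; apply/DeltaP => i iP; rewrite mxE x0 ?y0 ?addr0.
Qed.

Lemma DeltaZ P t x : x \in Delta F P -> t *: x \in Delta F P.
Proof. by move=> /DeltaP x0; apply/DeltaP => i iP; rewrite mxE x0 ?mulr0. Qed.

Lemma Delta_delta P i : i \in P -> delta_mx 0 i \in Delta F P.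
Proof. by move=> iP; apply/DeltaP => j; rewrite mxE /=; case: eqP => // ->; rewrite iP. Qed.

Lemma DeltaT x : x \in Delta F setT.
Proof. by apply/DeltaP => i; rewrite inE. Qed.

Lemma DeltaCT x : (x \in Delta F (~: setT)) = (x == 0).
Proof.
apply/DeltaCP/eqP => [x0 | -> i _]; last by rewrite mxE.
by apply/rowP => i; rewrite mxE x0 ?inE.
Qed.

Lemma Delta_cap P E x :
  (x \in Delta F P) && (x \in Delta F E) = (x \in Delta F (P :&: E)).
Proof. by rewrite !inE subsetI. Qed.

Lemma Delta_cap0 P x : x \in Delta F P -> x \in Delta F (~: P) -> x = 0.
Proof.
move=> /DeltaP xP /DeltaCP xCP; apply/rowP => i; rewrite mxE.
by case: (boolP (i \in P)) => [/xCP|/xP].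
Qed.

Lemma card_Delta P : #|Delta F P| = (q ^ #|P|)%N.
Proof.
rewrite -(card_pffun_on (0 : F) P predT) -(@card_imset _ _ (fun x : V => [ffun i => x 0 i])).
  apply: eq_card => f; apply/imsetP/pffun_onP => [[x /DeltaP xP ->] | [/supportP fP _]].
    split; last by move=> ? _.
    by apply/supportP => i /xP; rewrite ffunE.
  exists (\row_i f i); last by apply/ffunP => i; rewrite ffunE mxE.
  by apply/DeltaP => i /fP; rewrite mxE.
by move=> x y /ffunP xy; apply/rowP => i; have := xy i; rewrite !ffunE.
Qed.

Lemma card_DeltaC P : #|Delta F (~: P)| = (q ^ (m - #|P|))%N.
Proof. by rewrite card_Delta cardsCs setCK card_ord. Qed.

Lemma dotFC x y : dotF x y = dotF y x.
Proof. by apply: eq_bigr => i _; rewrite mulrC. Qed.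

Lemma dotFDl x x' y : dotF (x + x') y = dotF x y + dotF x' y.
Proof. by rewrite -big_split; apply: eq_bigr => i _; rewrite mxE mulrDl. Qed.

Lemma dotFZl t x y : dotF (t *: x) y = t * dotF x y.
Proof. by rewrite big_distrr /=; apply: eq_bigr => i _; rewrite mxE mulrA. Qed.

Lemma dotF0l x : dotF 0 x = 0.
Proof. by rewrite -(scale0r 0) dotFZl mul0r. Qed.

Lemma dotF_delta x i : dotF x (delta_mx 0 i) = x 0 i.
Proof.
rewrite /dotF (bigD1 i) //= mxE !eqxx mulr1 big1 ?addr0 // => j ji.
by rewrite mxE (negPf ji) andbF mulr0.
Qed.

Lemma dotF_Delta P x y : x \in Delta F (~: P) -> y \in Delta F P -> dotF x y = 0.
Proof.
move=> /DeltaCP xP /DeltaP yP; apply: big1 => i _.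
by case: (boolP (i \in P)) => [/xP | /yP] ->; rewrite ?mul0r ?mulr0.
Qed.

Definition box A E C : {set calR F m} :=
  setX (setX (Delta F A) (Delta F E)) (Delta F C).

Lemma in_box A E C (s : calR F m) :
  (s \in box A E C) = [&& s.1.1 \in Delta F A, s.1.2 \in Delta F E & s.2 \in Delta F C].
Proof. by case: s => [[d e] f]; rewrite 2!in_setX andbA. Qed.

Lemma card_box A E C : #|box A E C| = (q ^ (#|A| + #|E| + #|C|))%N.
Proof. by rewrite !cardsX !card_Delta !expnD. Qed.

(** This is the u-component of [pairing r s], hence a coordinate in the first half of the Gray
    image. *)
Definition lform (r s : calR F m) : F :=
  dotF r.1.1 s.1.2 + dotF r.1.2 s.1.1 + dotF r.2 s.2.

(** E and A are crossed because [lform] pairs the first component of r with the second of s and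
    conversely. *)
Definition ann_box A E C (r : calR F m) : bool :=
  [&& r.1.1 \in Delta F (~: E), r.1.2 \in Delta F (~: A) & r.2 \in Delta F (~: C)].

Lemma lformDl r r' s : lform (r + r') s = lform r s + lform r' s.
Proof. by rewrite /lform /= !dotFDl; ring. Qed.

Lemma lformZl t r s : lform (t *: r) s = t * lform r s.
Proof. by rewrite /lform /= !dotFZl; ring. Qed.

Lemma lformDr r s s' : lform r (s + s') = lform r s + lform r s'.
Proof. by rewrite /lform /= !(dotFC r.1.1, dotFC r.1.2, dotFC r.2) !dotFDl; ring. Qed.

Lemma lformZr t r s : lform r (t *: s) = t * lform r s.
Proof. by rewrite /lform /= !(dotFC r.1.1, dotFC r.1.2, dotFC r.2) !dotFZl; ring. Qed.

Lemma ann_box_lform A E C r s : ann_box A E C r -> s \in box A E C -> lform r s = 0.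
Proof.
rewrite in_box => /and3P[rE rA rC] /and3P[sA sE sC].
by rewrite /lform (dotF_Delta (P := E)) // (dotF_Delta (P := A)) // (dotF_Delta (P := C)) ?addr0 ?addr0.
Qed.

(** Some unit vector of the box detects the offending coordinate of r; scaling it makes the value
    1. *)
Lemma ann_boxN A E C r : ~~ ann_box A E C r -> exists2 s, s \in box A E C & lform r s = 1.
Proof.
move=> ann; suff [s sB lN] : exists2 s, s \in box A E C & lform r s != 0.
  exists ((lform r s)^-1 *: s); last by rewrite lformZr mulVf.
  by move: sB; rewrite !in_box /= => /and3P[? ? ?]; rewrite !DeltaZ.
have d0 x : dotF x 0 = 0 by rewrite dotFC dotF0l.
move: ann; rewrite !negb_and => /or3P[] /DeltaCPn[i iP ri].
- exists (0, delta_mx 0 i, 0); first by rewrite in_box /= !Delta0 Delta_delta.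
  by rewrite /lform /= !d0 !addr0 dotF_delta.
- exists (delta_mx 0 i, 0, 0); first by rewrite in_box /= !Delta0 Delta_delta.
  by rewrite /lform /= !d0 addr0 add0r dotF_delta.
exists (0, 0, delta_mx 0 i); first by rewrite in_box /= !Delta0 Delta_delta.
by rewrite /lform /= !d0 !add0r dotF_delta.
Qed.

(** Translation by [t *: s0], where the form takes the value 1 at s0, carries the fibre over 0 to
    the fibre over t. The q fibres thus have equal size, and q - 1 of them are counted. *)
Lemma card_box_lform A E C r : ~~ ann_box A E C r ->
  (q * #|[set s in box A E C | lform r s != 0%R]| = (q - 1) * #|box A E C|)%N.
Proof.
move=> /ann_boxN[s0 s0B l1].
pose X t := [set s in box A E C | lform r s == t].
have cX t : #|X t| = #|X 0|.
  rewrite -[RHS](card_imset _ (addrI (t *: s0))); apply: eq_card => s.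
  rewrite inE; apply/andP/imsetP => [[sB /eqP ls] | [s']].
    exists (s - t *: s0); last by rewrite addrC subrK.
    rewrite inE -scaleNr lformDr lformZr l1 ls mulr1 subrr eqxx andbT.
    move: sB s0B; rewrite !in_box /= => /and3P[? ? ?] /and3P[? ? ?].
    by rewrite !DeltaD ?DeltaZ.
  rewrite inE => /andP[s'B /eqP ls'] ->; rewrite lformDr lformZr l1 ls' mulr1 addr0.
  split=> //; move: s'B s0B; rewrite !in_box /= => /and3P[? ? ?] /and3P[? ? ?].
  by rewrite !DeltaD ?DeltaZ.
have cB : (#|box A E C| = q * #|X 0%R|)%N.
  rewrite -sum1_card (partition_big (lform r) predT) //= -sum_card_const.
  by apply: eq_bigr => t _; rewrite -(cX t) -sum1_card; apply: eq_bigl => s; rewrite [RHS]inE.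
have := cardsID (X 0) (box A E C).
have -> : box A E C :&: X 0 = X 0 by apply/setIidPr/subsetP => s; rewrite inE => /andP[].
have -> : box A E C :\: X 0 = [set s in box A E C | lform r s != 0].
  by apply/setP => s; rewrite in_setD [in RHS]inE [X in ~~ X]inE; case: (s \in box A E C); rewrite ?andbF ?andbT.
rewrite cB; move: q #|X 0| #|_| => *; nia.
Qed.

Lemma card_box_lform0 A E C r : ann_box A E C r ->
  #|[set s in box A E C | lform r s != 0]| = 0%N.
Proof.
move=> ann; apply: eq_card0 => s; rewrite inE; apply/negP => /andP[sB].
by rewrite (ann_box_lform ann) ?eqxx.
Qed.

End Box.

(** * Hamming weights of concatenated and enumerated vectors *)

Lemma wt_eq0 (F : finFieldType) N (x : 'rV[F]_N) : (wt x == 0)%N = (x == 0).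
Proof.
rewrite cards_eq0; apply/eqP/eqP => [/setP s0 | ->].
  by apply/rowP => i; have := s0 i; rewrite !inE mxE => /negbFE/eqP.
by apply/setP => i; rewrite !inE mxE eqxx.
Qed.

Lemma wt_row_mx (F : finFieldType) N1 N2 (x : 'rV[F]_N1) (y : 'rV[F]_N2) :
  wt (row_mx x y) = (wt x + wt y)%N.
Proof.
rewrite /wt -!sum1_card !(big_mkcond (fun i => i \in supp _)) big_split_ord /=.
by congr addn; apply: eq_bigr => i _; rewrite !inE ?row_mxEl ?row_mxEr.
Qed.

Lemma wt_row_enum (F : finFieldType) (T : finType) (D : {set T}) (f : T -> F) :
  wt (\row_(j < #|D|) f (enum_val j)) = #|[set s in D | f s != 0]|.
Proof.
rewrite /wt -(card_imset _ (@enum_val_inj T (mem D))); apply: eq_card => s.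
rewrite inE; apply/imsetP/andP => [[j] | [sD fs]].
  by rewrite inE mxE => fj ->; rewrite enum_valP.
by exists (enum_rank_in sD s); rewrite ?inE ?mxE enum_rankK_in.
Qed.

(** * Self-orthogonality from divisibility of the weights *)

Section SelfOrthogonal.
Variables (F : finFieldType) (N : nat) (V : {vspace 'rV[F]_N}).

(** Over the field of two elements x.y is the parity of the common support. Twice the size of that
    support is wt x + wt y - wt (x + y), a multiple of 4. *)
Lemma self_orthogonal_binary :
  #|F| = 2 -> (forall c, c \in V -> 4 %| wt c)%N -> self_orthogonal V.
Proof.
move=> q2 wt4 x y xV yV.
have char2 : 2%:R = 0 :> F.
  by have /pcharf0 := @card_finPcharP F 2 1 q2 isT.
have bin (t : F) : t = (t != 0)%:R.
  case: eqVneq => [//|tN]; apply/eqP; rewrite -subr_eq0.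
  by have := expf_card t; rewrite q2 => /eqP; rewrite -subr_eq0 expr2 -{3}[t]mulr1
    -mulrBr mulf_eq0 (negPf tN).
have -> : dotF x y = #|supp x :&: supp y|%:R.
  rewrite -sum1_card natr_sum [RHS]big_mkcond; apply: eq_bigr => i _.
  rewrite !inE [x 0 i in LHS]bin [y 0 i in LHS]bin.
  by case: (x 0 i != 0); case: (y 0 i != 0); rewrite ?mulr1 ?mulr0 ?mul0r.
have wtD : (wt (x + y) + 2 * #|supp x :&: supp y| = wt x + wt y)%N.
  rewrite /wt -[X in _ = (X + _)%N](cardsID (supp y)) -[X in _ = (_ + X)%N](cardsID (supp x)).
  rewrite (setIC (supp y)).
  have -> : supp (x + y) = (supp x :\: supp y) :|: (supp y :\: supp x).
    apply/setP => i; rewrite !inE mxE.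
    have [->|xN] := eqVneq (x 0 i) 0; first by rewrite add0r andbF /= ?andbT.
    have [->|yN] := eqVneq (y 0 i) 0; first by rewrite addr0 ?xN /= ?andbT ?orbF.
    by rewrite (bin (x 0 i)) (bin (y 0 i)) xN yN -natrD char2 eqxx.
  rewrite cardsU; have -> : (supp x :\: supp y) :&: (supp y :\: supp x) = set0.
    by apply/setP => i; rewrite !inE; case: (x 0 i == 0); rewrite ?andbF.
  by rewrite cards0; lia.
have : (2 %| #|supp x :&: supp y|)%N.
  move: wtD (wt4 _ (rpredD xV yV)) (wt4 _ xV) (wt4 _ yV).
  move: (wt (x + y)) (wt x) (wt y) #|_| => n1 n2 n3 n4.
  by move=> ? /dvdnP[k1 ?] /dvdnP[k2 ?] /dvdnP[k3 ?]; apply/dvdnP; exists (k2 + k3 - k1)%N; lia.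
by case/dvdnP => k ->; rewrite natrM char2 mulr0.
Qed.

(** Nonzero squares are 1, so z.z is wt z modulo 3, which vanishes on the code. Polarisation gives 2
    x.y = 0, and 2 is invertible. *)
Lemma self_orthogonal_ternary :
  #|F| = 3 -> (forall c, c \in V -> 3 %| wt c)%N -> self_orthogonal V.
Proof.
move=> q3 wt3 x y xV yV.
have char3 : 3%:R = 0 :> F.
  by have /pcharf0 := @card_finPcharP F 3 1 q3 isT.
have sq (t : F) : t * t = (t != 0)%:R.
  case: eqVneq => [->|tN]; first by rewrite mulr0.
  by apply: (mulfI tN); rewrite mulr1 -[RHS]expf_card q3 !exprS expr0 mulr1.
have iso z : z \in V -> dotF z z = 0.
  move=> zV; have -> : dotF z z = (wt z)%:R.
    rewrite /wt -sum1_card natr_sum [RHS]big_mkcond; apply: eq_bigr => i _.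
    by rewrite sq inE; case: (z 0 i != 0).
  by have /dvdnP[k ->] := wt3 z zV; rewrite natrM char3 mulr0.
have := iso _ (rpredD xV yV).
rewrite dotFDl !(dotFC _ (x + y)) !dotFDl !iso // add0r addr0 (dotFC y x).
move=> xy2; have : 3%:R * dotF x y = 0 by rewrite char3 mul0r.
by rewrite -[3%N]/(1 + 2)%N natrD mulrDl mul1r mulr2n mulrDl mul1r xy2 addr0.
Qed.

End SelfOrthogonal.

(** * The code of [S3]: length, encoding and weights *)

Section Code.
Variables (F : finFieldType) (m : nat) (A B C : {set 'I_m}).
Hypotheses (A0 : A != set0) (B0 : B != set0) (C0 : C != set0).
Hypotheses (Bm : (#|B| < m)%N) (AB : ~~ (A \subset B)).

Local Notation q := #|F|.
Local Notation a := #|A|.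
Local Notation b := #|B|.
Local Notation c := #|C|.
Local Notation ab := #|A :|: B|.
Local Notation D := (@S3 F m A B C).
Definition w1 := (2 * (q - 1) * q ^ (a + c - 1) * (q ^ m - q ^ b))%N.
Definition w2 := ((q - 1) * q ^ (a + c - 1) * (2 * q ^ m - q ^ b))%N.
Definition w3 := (2 * (q - 1) * q ^ (m + a + c - 1))%N.

Let q_gt1 : (1 < q)%N := finNzRing_gt1 F.
Let q_gt0 : (0 < q)%N := ltnW q_gt1.
Let a_gt0 : (0 < a)%N. Proof. by rewrite card_gt0. Qed.
Let b_gt0 : (0 < b)%N. Proof. by rewrite card_gt0. Qed.
Let c_gt0 : (0 < c)%N. Proof. by rewrite card_gt0. Qed.
Let b_lt_ab : (b < ab)%N.
Proof.
apply: proper_card; rewrite properE subsetUr /=.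
by apply: contraNN AB => /(subset_trans (subsetUl A B)).
Qed.
Let ab_le_m : (ab <= m)%N. Proof. by rewrite -[X in (_ <= X)%N]card_ord max_card. Qed.

Lemma S3_box : D = box F A setT C :\: box F A B C.
Proof.
apply/setP => s; rewrite [LHS]inE in_setD !in_box DeltaT /=.
by case: (_ \in Delta F A); case: (_ \in Delta F B); case: (_ \in Delta F C).
Qed.

Lemma box_sub : box F A B C \subset box F A setT C.
Proof. by apply/subsetP => s; rewrite !in_box DeltaT => /and3P[-> _ ->]. Qed.

Lemma card_S3 : #|D| = (q ^ (a + c) * (q ^ m - q ^ b))%N.
Proof.
rewrite S3_box cardsD (setIidPr box_sub) !card_box cardsT card_ord mulnBr -!expnD.
by rewrite (addnAC a m) (addnAC a b).
Qed.

(** The count on the large box minus that on the small one, each being (q - 1)/q of the box or zero.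
    The truncated subtraction is harmless: a form that annihilates the large box annihilates the
    small one. *)
Lemma card_S3_lform r :
  #|[set s in D | lform r s != 0]|
    = ((q - 1) * q ^ (a + c - 1) *
        (~~ ann_box A setT C r * q ^ m - ~~ ann_box A B C r * q ^ b))%N.
Proof.
have card_ann E : #|[set s in box F A E C | lform r s != 0]|
    = ((q - 1) * q ^ (a + c - 1) * (~~ ann_box A E C r * q ^ #|E|))%N.
  have [ann | ann] := boolP (ann_box A E C r).
    by rewrite card_box_lform0 // mul0n muln0.
  apply/eqP; rewrite -(eqn_pmul2l q_gt0) card_box_lform // card_box mul1n; apply/eqP.
  rewrite -mulnA [RHS]mulnCA; congr muln; rewrite -expnD -expnS; congr expn; lia.
have -> : [set s in D | lform r s != 0]
    = [set s in box F A setT C | lform r s != 0]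
      :\: [set s in box F A B C | lform r s != 0].
  apply/setP => s; rewrite S3_box !inE.
  by case: (lform r s == 0); rewrite ?andbF ?andbT.
rewrite cardsD (setIidPr _) ?card_ann ?cardsT ?card_ord ?mulnBr //.
apply/subsetP => s; rewrite in_set => /andP[sB ls].
by rewrite in_set ls (subsetP box_sub).
Qed.

(** The second half of the Gray map adds the term d1.d2 to [lform]; it is absorbed by replacing e1
    with d1 + e1. *)
Definition twist (r : calR F m) : calR F m := (r.1.1, r.1.1 + r.1.2, r.2).

Definition graycode (r : calR F m) : 'rV[F]_(#|D| + #|D|) :=
  row_mx (\row_j lform r (enum_val j)) (\row_j lform (twist r) (enum_val j)).

Lemma RdotE (d1 e1 d2 e2 : 'rV[F]_m) :
  Rdot d1 e1 d2 e2 = (dotF d1 d2, dotF d1 e2 + dotF e1 d2).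
Proof.
rewrite /Rdot /dotF -big_split.
by elim/big_rec3: _ => // i x y z _ ->.
Qed.

Lemma Gray_pairing r :
  Gray (fun j : 'I_#|D| => pairing r (enum_val j)) = graycode r.
Proof.
congr row_mx; apply/rowP => j; rewrite !mxE /pairing RdotE /lform //=.
by rewrite dotFDl; ring.
Qed.

Lemma graycode_linear : linear graycode.
Proof.
move=> t r s; rewrite /graycode scale_row_mx add_row_mx.
congr row_mx; apply/rowP => j; rewrite !mxE -lformZl -lformDl //.
congr lform; rewrite -[RHS]/(t *: r.1.1 + s.1.1,
  t *: (r.1.1 + r.1.2) + (s.1.1 + s.1.2), t *: r.2 + s.2).
by rewrite scalerDr addrACA.
Qed.

HB.instance Definition _ := GRing.isLinear.Build F (calR F m) 'rV[F]_(#|D| + #|D|) _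
  graycode graycode_linear.

Definition code : {vspace 'rV[F]_(#|D| + #|D|)} := limg (linfun graycode).

Lemma mem_code x : reflect (exists r, x = graycode r) (x \in code).
Proof.
apply: (iffP memv_imgP) => [[r _ ->] | [r ->]]; exists r; rewrite ?lfunE ?memvf //.
Qed.

Lemma mem_code_GrayCode x : (x \in code) = (x \in GrayCode D).
Proof.
apply/mem_code/imsetP => [[r ->] | [r _ ->]]; exists r => //.
  by rewrite Gray_pairing.
by rewrite Gray_pairing.
Qed.

Let qb_lt_qm : (q ^ b < q ^ m)%N. Proof. by rewrite ltn_exp2l. Qed.

Lemma w1E : (w1 = (q - 1) * q ^ (a + c - 1) * (2 * (q ^ m - q ^ b)))%N.
Proof. by rewrite /w1 -!mulnA mulnCA; congr muln; rewrite mulnCA. Qed.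

Lemma w3E : (w3 = (q - 1) * q ^ (a + c - 1) * (2 * q ^ m))%N.
Proof.
rewrite /w3; have -> : (m + a + c - 1 = a + c - 1 + m)%N by lia.
by rewrite expnD -!mulnA mulnCA; congr muln; rewrite mulnCA.
Qed.

(** The elements r and [twist r] differ only in the second component, so the conditions on d and f
    are common to both forms. With u = (q - 1)q^(a+c-1), a form contributes u (q^m - q^b) if it
    annihilates neither box, u q^m if only the small one, and 0 if both. For d = 0 the two forms
    coincide. *)
Lemma wt_graycode r :
  wt (graycode r) =
    if (r.2 \in Delta F (~: C)) && (r.1.1 \in Delta F (~: B)) then
      match r.1.2 \in Delta F (~: A), r.1.1 + r.1.2 \in Delta F (~: A) with
      | true, true => if r.1.1 == 0 then 0 else w3
      | false, false => w1
      | _, _ => w2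
      end
    else w1.
Proof.
rewrite wt_row_mx wt_row_enum (wt_row_enum D (lform (twist r))) !card_S3_lform.
rewrite -mulnDr /ann_box /= !DeltaCT.
rewrite w1E w3E /w2.
move: (q ^ m)%N (q ^ b)%N qb_lt_qm ((q - 1) * _)%N => qm qb qbm u.
have [-> | dN] /= := eqVneq r.1.1 0.
  rewrite Delta0 add0r !andbT /=.
  case: (r.1.2 \in _); case: (r.2 \in _) => /=; rewrite ?muln0 //; congr muln; lia.
case: (r.1.1 \in _); case: (r.2 \in _); case: (r.1.2 \in _);
  by case: (_ + _ \in _) => /=; congr muln; lia.
Qed.

Let u_gt0 : (0 < (q - 1) * q ^ (a + c - 1))%N.
Proof. by rewrite muln_gt0 subn_gt0 q_gt1 expn_gt0 q_gt0. Qed.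

Let w1_gt0 : (0 < w1)%N.
Proof. by rewrite /w1 -mulnA -mulnA muln_gt0 mulnA muln_gt0 u_gt0 subn_gt0. Qed.

Let w1_lt_w2 : (w1 < w2)%N.
Proof.
rewrite w1E /w2 ltn_pmul2l //; have := expn_gt0 q b; rewrite q_gt0.
by move: qb_lt_qm; lia.
Qed.

Let w2_lt_w3 : (w2 < w3)%N.
Proof.
rewrite w3E /w2 ltn_pmul2l //; have := expn_gt0 q b; rewrite q_gt0.
by move: qb_lt_qm; lia.
Qed.

(** * Parametrisation, dimension and weight frequencies *)

Definition proj (P : {set 'I_m}) (x : 'rV[F]_m) : 'rV[F]_m :=
  \row_i (if i \in P then x 0 i else 0).

Lemma proj_Delta P x : proj P x \in Delta F P.
Proof. by apply/DeltaP => i /negPf iP; rewrite mxE iP. Qed.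

Lemma sub_proj_Delta P x : x - proj P x \in Delta F (~: P).
Proof. by apply/DeltaCP => i iP; rewrite !mxE iP subrr. Qed.

(** Describes the kernel of the encoding: w1, w2 and w3 are positive, so only the zero branch of
    [wt_graycode] survives. *)
Lemma graycode_eq0 r : (graycode r == 0) =
  [&& r.1.1 == 0, r.1.2 \in Delta F (~: A) & r.2 \in Delta F (~: C)].
Proof.
rewrite -wt_eq0 wt_graycode.
have [-> | dN] /= := eqVneq r.1.1 0; last first.
  apply/negbTE; case: ifP => _; last by rewrite -lt0n.
  by case: (_ \in _); case: (_ \in _); move: w1_gt0 w1_lt_w2 w2_lt_w3; lia.
rewrite Delta0 add0r andbT; case: (r.2 \in _); case: (r.1.2 \in _) => //=; lia.
Qed.

(** A complement of the kernel of [graycode], containing one representative of each codeword. *)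
Definition params : {set calR F m} := setX (setX setT (Delta F A)) (Delta F C).

Lemma wt_graycode_w2 r : (wt (graycode r) == w2) =
  [&& r.2 \in Delta F (~: C), r.1.1 \in Delta F (~: B)
    & (r.1.2 \in Delta F (~: A)) (+) (r.1.1 + r.1.2 \in Delta F (~: A))].
Proof.
have n12 : (w1 == w2) = false by rewrite ltn_eqF.
have n32 : (w3 == w2) = false by rewrite gtn_eqF.
have n02 : (0 == w2)%N = false by rewrite ltn_eqF // (ltn_trans w1_gt0).
rewrite wt_graycode; case: (r.2 \in _); case: (r.1.1 \in _); rewrite ?n12 //=.
by case: (r.1.2 \in _); case: (_ + _ \in _); rewrite ?eqxx ?n12 //=; case: ifP.
Qed.

Lemma wt_graycode_w3 r : (wt (graycode r) == w3) =
  [&& r.2 \in Delta F (~: C), r.1.1 \in Delta F (~: (A :|: B)),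
    r.1.2 \in Delta F (~: A) & r.1.1 != 0].
Proof.
have n13 : (w1 == w3) = false by rewrite ltn_eqF // (ltn_trans w1_lt_w2).
have n23 : (w2 == w3) = false by rewrite ltn_eqF.
have n03 : (0 == w3)%N = false.
  by rewrite ltn_eqF // (ltn_trans w1_gt0) // (ltn_trans w1_lt_w2).
rewrite wt_graycode setCU -Delta_cap; case: (r.2 \in _); rewrite ?n13 //=.
case: (r.1.1 \in Delta F (~: B)); rewrite ?n13 ?andbF ?andbT //=.
have [eA | nA] := boolP (r.1.2 \in Delta F (~: A)); last first.
  by rewrite andbF; case: ifP.
(* Once e lies in the subspace, d + e lies in it iff d does; with the condition on B this places d
   in the complement of A :|: B. *)
have -> : (r.1.1 + r.1.2 \in Delta F (~: A)) = (r.1.1 \in Delta F (~: A)).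
  apply/idP/idP => [deA | dA]; last exact: DeltaD.
  by rewrite -[r.1.1](addrK r.1.2) -scaleN1r DeltaD ?DeltaZ.
by case: (r.1.1 \in _) => /=; [case: (r.1.1 == 0) => /= |]; rewrite ?eqxx ?n03 ?n23.
Qed.

Lemma in_params r :
  (r \in params) = (r.1.2 \in Delta F A) && (r.2 \in Delta F C).
Proof. by case: r => [[d e] f]; rewrite !in_setX in_setT. Qed.

Lemma wt_mem r : wt (graycode r) \in [:: 0; w1; w2; w3]%N.
Proof.
rewrite wt_graycode; case: ifP => _; last by rewrite !inE eqxx orbT.
case: (r.1.2 \in Delta F (~: A)); case: (_ + _ \in Delta F (~: A)); try case: ifP => _;
  by rewrite !inE eqxx ?orbT.
Qed.

Lemma card_params : #|params| = (q ^ (m + a + c))%N.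
Proof.
have DT : [set: 'rV[F]_m] = Delta F setT by apply/setP => x; rewrite DeltaT inE.
by rewrite !cardsX DT !card_Delta cardsT card_ord !expnD.
Qed.

Lemma graycode_inj : {in params &, injective graycode}.
Proof.
move=> r s; rewrite !in_params => /andP[rA rC] /andP[sA sC] /eqP.
rewrite -subr_eq0 -linearB graycode_eq0 => /and3P[/= d0 eA fC].
have subD P x y : x \in Delta F P -> y \in Delta F P -> x - y \in Delta F P.
  by move=> xP yP; rewrite -scaleN1r DeltaD ?DeltaZ.
have /subr0_eq e0 := Delta_cap0 (subD _ _ _ _ rA sA) eA.
have /subr0_eq f0 := Delta_cap0 (subD _ _ _ _ rC sC) fC.
move: d0 e0 f0; rewrite subr_eq0.
by case: r {rA rC eA fC} => [[? ?] ?]; case: s {sA sC} => [[? ?] ?] /= /eqP -> -> ->.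
Qed.

(** Projecting e to A and f to C changes r by an element of the kernel. *)
Lemma code_params x : (x \in code) = (x \in graycode @: params).
Proof.
apply/mem_code/imsetP => [[r ->] | [r _ ->]]; last by exists r.
pose r' : calR F m := (r.1.1, proj A r.1.2, proj C r.2).
exists r'; first by rewrite in_params !proj_Delta.
apply/eqP; rewrite -subr_eq0 -linearB graycode_eq0 /= subrr eqxx.
by rewrite !sub_proj_Delta.
Qed.

Lemma dim_code : \dim code = (m + a + c)%N.
Proof.
apply/eqP; rewrite -(eqn_exp2l _ _ q_gt1) -card_params -(card_in_imset graycode_inj).
by rewrite -card_vspace; apply/eqP/eq_card => x; rewrite code_params.
Qed.

Lemma freq_code w : freq code w = #|[set r in params | wt (graycode r) == w]|.
Proof.
rewrite -[RHS](card_in_imset (f := graycode)); last first.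
  move=> r s; rewrite in_set => /andP[rP _]; rewrite in_set => /andP[sP _].
  exact: graycode_inj.
apply: eq_card => x; rewrite inE code_params; apply/andP/imsetP.
  by case=> /imsetP[r rP ->] wr; exists r; rewrite // in_set rP.
by case=> r; rewrite in_set => /andP[rP wr] ->; rewrite imset_f.
Qed.

(** On [params] the conditions force e = f = 0 and leave d free among the nonzero vectors supported
    off A :|: B. *)
Lemma freq_w3 : freq code w3 = (q ^ (m - ab) - 1)%N.
Proof.
pose f (d : 'rV[F]_m) : calR F m := (d, 0, 0).
have f_inj : injective f by move=> d d' [].
rewrite freq_code -card_DeltaC [in RHS](cardsD1 0) Delta0 addKn -(card_imset _ f_inj).
apply: eq_card => r; rewrite in_set wt_graycode_w3 in_params.
apply/andP/imsetP => [[/andP[eA fC] /and4P[fC' dAB eA' d0]] | [d]].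
  exists r.1.1; first by rewrite !inE d0; rewrite inE in dAB.
  rewrite /f -{1}(Delta_cap0 eA eA') -(Delta_cap0 fC fC').
  by case: r {eA fC fC' dAB eA' d0} => [[]].
by rewrite in_setD1 => /andP[d0 dAB] ->; rewrite /= !Delta0 d0 dAB.
Qed.

(** Exactly one of the two forms annihilates the small box. On [params] the first one does iff e =
    0, the twisted one iff e = - proj A d; in both cases d ranges over X. The families are disjoint
    because [proj A d] is nonzero on X. *)
Lemma freq_w2 : freq code w2 = (2 * (q ^ (m - b) - q ^ (m - ab)))%N.
Proof.
pose X := Delta F (~: B) :\: Delta F (~: A).
have cX : #|X| = (q ^ (m - b) - q ^ (m - ab))%N.
  rewrite cardsD card_DeltaC; congr subn; rewrite -card_DeltaC setCU.
  by apply: eq_card => d; rewrite in_setI andbC Delta_cap.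
pose f (d : 'rV[F]_m) : calR F m := (d, 0, 0).
pose g (d : 'rV[F]_m) : calR F m := (d, - proj A d, 0).
have f_inj : injective f by move=> d d' [].
have g_inj : injective g by move=> d d' [].
have DeltaN P x : x \in Delta F P -> - x \in Delta F P.
  by move=> xP; rewrite -scaleN1r DeltaZ.
have projN d : d \in X -> - proj A d \notin Delta F (~: A).
  rewrite in_setD => /andP[dA _]; apply: contraNN dA => /DeltaN; rewrite opprK => pA.
  by rewrite -[d](subrK (proj A d)) DeltaD ?sub_proj_Delta.
rewrite freq_code; have -> : [set r in params | wt (graycode r) == w2] = f @: X :|: g @: X.
  apply/setP => r; rewrite in_set wt_graycode_w2 in_params in_setU.
  apply/andP/orP => [[/andP[eA fC] /and3P[fC' dB]] | [] /imsetP[d dX ->]]; last 2 first.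
  - rewrite /= !Delta0 addr0; move: dX; rewrite in_setD => /andP[/negPf -> ->].
    by [].
  - rewrite /= !Delta0 (negPf (projN _ dX)) sub_proj_Delta DeltaN ?proj_Delta //.
    by move: dX; rewrite in_setD => /andP[_ ->].
  have f0 := Delta_cap0 fC fC'.
  have [eA' /= deA | eA' /= deA] := boolP (r.1.2 \in Delta F (~: A)).
    left; have e0 := Delta_cap0 eA eA'.
    apply/imsetP; exists r.1.1.
      by rewrite in_setD dB andbT; move: deA; rewrite e0 addr0.
    by rewrite /f -{1}e0 -f0; case: r {eA fC fC' dB f0 eA' deA e0} => [[]].
  right; have e0 : r.1.2 = - proj A r.1.1.
    apply/eqP; rewrite -addr_eq0; apply/eqP.
    apply: (@Delta_cap0 _ _ A); first by rewrite DeltaD ?proj_Delta.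
    have -> : r.1.2 + proj A r.1.1 = r.1.1 + r.1.2 - (r.1.1 - proj A r.1.1).
      by rewrite opprB [r.1.1 + _]addrC -addrA [r.1.1 + _]addrC subrK.
    by rewrite DeltaD ?DeltaN ?sub_proj_Delta.
  apply/imsetP; exists r.1.1; last first.
    by rewrite /g -e0 -f0; case: r {eA fC fC' dB f0 eA' deA e0} => [[]].
  rewrite in_setD dB andbT; apply: contraNN eA' => dA; rewrite e0 DeltaN //.
  by rewrite -[proj A _](subKr r.1.1) DeltaD ?DeltaN ?sub_proj_Delta.
rewrite [LHS]cardsU (card_imset _ f_inj) (card_imset _ g_inj) cX; have -> : f @: X :&: g @: X = set0.
  apply/setP => r; rewrite in_setI [RHS]inE; apply/negP => /andP[/imsetP[d dX ->]].
  by case/imsetP => d' d'X [_ p0]; have := projN _ d'X; rewrite -p0 Delta0.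
by rewrite cards0 subn0 addnn mul2n.
Qed.

Lemma freq_code0 : freq code 0 = 1%N.
Proof.
apply: (eq_card1 (x := 0)) => x; rewrite !inE wt_eq0.
by have [-> | _] := eqVneq x 0; rewrite ?andbF // mem0v.
Qed.

Lemma freq_sum :
  (freq code 0 + freq code w1 + freq code w2 + freq code w3 = q ^ (m + a + c))%N.
Proof.
have sumE w : freq code w = (\sum_(r in params) (wt (graycode r) == w))%N.
  rewrite freq_code -sum1_card (eq_bigl [pred r | (r \in params) && (wt (graycode r) == w)]).
    by rewrite big_mkcondr; apply: eq_bigr => r _; case: eqP.
  by move=> r; rewrite in_set.
rewrite !sumE -!big_split -card_params -[RHS]sum1_card; apply: eq_bigr => r _ /=.
have := wt_mem r; rewrite !inE.
move: (wt _) => w; move: w1_gt0 w1_lt_w2 w2_lt_w3.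
by do 4![case: eqP => ? //=]; lia.
Qed.

(** Obtained by subtracting the other frequencies, including that of the zero word, from the size of
    the code. *)
Lemma freq_w1 :
  freq code w1 = (q ^ (m + a + c) - 2 * q ^ (m - b) + q ^ (m - ab))%N.
Proof.
have := freq_sum; rewrite freq_code0 freq_w2 freq_w3.
have : (0 < q ^ (m - ab))%N by rewrite expn_gt0 q_gt0.
have : (q ^ (m - ab) <= q ^ (m - b))%N by rewrite leq_exp2l //; move: b_lt_ab; lia.
(* Needed because the subtraction in the statement is truncated. *)
have : (2 * q ^ (m - b) <= q ^ (m + a + c))%N.
  apply: (@leq_trans (q ^ (m - b).+1)); first by rewrite expnS leq_mul2r q_gt1 orbT.
  by rewrite leq_exp2l //; move: a_gt0; lia.
move: (q ^ (m + a + c))%N (q ^ (m - b))%N (q ^ (m - ab))%N (freq code w1) => x y z t.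
lia.
Qed.

Lemma code_wt x : x \in code -> x != 0 -> wt x \in [:: w1; w2; w3].
Proof.
case/mem_code => r -> rN; have := wt_mem r.
by rewrite inE wt_eq0 (negPf rN).
Qed.

Lemma freq_gt0P w : reflect (exists2 x, x \in code & wt x = w) (0 < freq code w)%N.
Proof.
apply: (iffP card_gt0P) => [[x /andP[xV /eqP xw]] | [x xV xw]]; exists x => //.
by rewrite inE xV xw eqxx.
Qed.

Lemma freq_w1_gt0 : (0 < freq code w1)%N.
Proof. by rewrite freq_w1 addn_gt0 expn_gt0 q_gt0 orbT. Qed.

Lemma freq_w2_gt0 : (0 < freq code w2)%N.
Proof.
by rewrite freq_w2 muln_gt0 subn_gt0 ltn_exp2l //=; move: b_lt_ab ab_le_m; move: ab b => x y; lia.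
Qed.

Lemma freq_w3_gt0 : (0 < freq code w3)%N = (A :|: B != setT).
Proof.
rewrite freq_w3 subn_gt0 -{1}(expn0 q) ltn_exp2l // subn_gt0.
by rewrite -properT properEcard subsetT cardsT card_ord.
Qed.

(** * Parameters, minimality, optimality and self-orthogonality *)

Lemma code_is_kd : is_code_kd code (m + a + c) w1.
Proof.
split; first exact: dim_code.
  have /freq_gt0P[x xV xw] := freq_w1_gt0; exists x => //.
  by rewrite -wt_eq0 xw eqxx andbT -lt0n.
move=> x xV xN; have := code_wt xV xN; rewrite !inE.
by move: w1_lt_w2 w2_lt_w3; lia.
Qed.

Lemma mem_weights w : (w \in weights code) = (0 < w)%N && (0 < freq code w)%N.
Proof.
rewrite mem_undup; apply/mapP/andP => [[x] | [w0 /freq_gt0P[x xV xw]]].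
  rewrite mem_enum => /andP[xV xN] ->; rewrite lt0n wt_eq0 xN.
  by split=> //; apply/freq_gt0P; exists x.
by exists x; rewrite // mem_enum inE xV -wt_eq0 xw -lt0n.
Qed.

Lemma size_weights : size (weights code) = (2 + (A :|: B != setT))%N.
Proof.
have w13 : w1 != w3 by rewrite ltn_eqF // (ltn_trans w1_lt_w2).
(* The weight w3 is listed once or not at all, according to [freq_w3_gt0]. *)
pose ws := [:: w1; w2] ++ nseq (A :|: B != setT) w3.
have -> : (2 + (A :|: B != setT))%N = size ws by rewrite size_cat size_nseq.
apply/perm_size/uniq_perm; first exact: undup_uniq.
  by rewrite /ws; case: (_ != _) => /=; rewrite !inE ?negb_or ?w13 !neq_ltn ?w1_lt_w2 ?w2_lt_w3.
move=> w; rewrite mem_weights mem_cat mem_nseq !inE -freq_w3_gt0 lt0b.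
apply/andP/idP => [[w0 fw] | ].
  have /freq_gt0P[x xV xw] := fw.
  have := code_wt xV; rewrite -wt_eq0 xw -lt0n w0 !inE => /(_ isT).
  by case/or3P => /eqP we; rewrite we in fw *; rewrite ?fw eqxx ?orbT.
case/orP=> [/orP[] /eqP -> | /andP[fw /eqP ->]]; split=> //.
- exact: freq_w1_gt0.
- exact: ltn_trans w1_lt_w2.
- exact: freq_w2_gt0.
- exact: ltn_trans (ltn_trans w1_lt_w2 _).
Qed.

Lemma code_minimal : minimal_code code.
Proof.
have qb0 : (0 < q ^ b)%N by rewrite expn_gt0 q_gt0.
have wt_bounds x : x \in code -> x != 0 -> wt x != w3 -> (w1 <= wt x <= w2)%N.
  move=> xV xN; have := code_wt xV xN; rewrite !inE.
  by move: w1_lt_w2 w2_lt_w3; lia.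
(* The ratio of w1 to w3 meets the criterion only if b + 1 < m. This follows from b < ab < m when A
   :|: B is proper; otherwise w3 does not occur and w2 is the largest weight. *)
have [ABT | ABN] := eqVneq (A :|: B) setT.
  apply: (@minimal_code_bound _ _ _ w1 w2) => [x xV xN|].
    apply: wt_bounds => //; apply/eqP => xw.
    have : (0 < freq code w3)%N by apply/freq_gt0P; exists x.
    by rewrite freq_w3_gt0 ABT eqxx.
  rewrite w1E /w2 mulnCA (mulnCA q) ltn_pmul2l //.
  have : (q * q ^ b <= q ^ m)%N by rewrite -expnS leq_exp2l.
  by move: (q ^ b)%N (q ^ m)%N q qb0 q_gt1 => Y X Q *; nia.
apply: (@minimal_code_bound _ _ _ w1 w3) => [x xV xN|].
  by have := code_wt xV xN; rewrite !inE; move: w1_lt_w2 w2_lt_w3; lia.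
rewrite w1E w3E mulnCA (mulnCA q) ltn_pmul2l //.
have : (q * q ^ b < q ^ m)%N.
  rewrite -expnS ltn_exp2l //; apply: leq_ltn_trans b_lt_ab _.
  by move: ABN; rewrite -properT properEcard subsetT cardsT card_ord.
by move: (q ^ b)%N (q ^ m)%N q qb0 q_gt1 => Y X Q *; nia.
Qed.

(** The exponent m - b is written as a successor to match [griesmer_sum_dual]. *)
Lemma w1_dual_distance : w1 = dual_distance q (m - b.+1).+1 (a + b + c - 1).
Proof.
rewrite /w1 /dual_distance -!mulnA; do 2 congr muln.
by rewrite mulnBr -!expnD; congr (_ ^ _ - _ ^ _)%N; lia.
Qed.

Lemma length_code : (#|D| + #|D| = 2 * q ^ (a + c) * (q ^ m - q ^ b))%N.
Proof. by rewrite addnn -mul2n card_S3 mulnA. Qed.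

Lemma length_dual :
  (#|D| + #|D| = 2 * (q ^ ((m - b.+1).+1 + (a + b + c - 1).+1)
                       - q ^ (a + b + c - 1).+1))%N.
Proof.
rewrite length_code -mulnA mulnBr -!expnD; congr (2 * (_ ^ _ - _ ^ _))%N.
  by move: a_gt0 Bm; lia.
by move: a_gt0; lia.
Qed.

Let dimE : (m + a + c = (m - b.+1).+1 + (a + b + c - 1).+1)%N.
Proof. by move: a_gt0 Bm; lia. Qed.

Lemma code_near_griesmer : near_griesmer F (#|D| + #|D|) (m + a + c) w1.
Proof.
rewrite /near_griesmer -/(griesmer_sum q _ _) w1_dual_distance dimE.
by rewrite griesmer_sum_dual // length_dual subn1.
Qed.

Lemma code_distance_optimal : distance_optimal code (m + a + c) w1.
Proof.
case=> V' [dimV' _ wtV'].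
have := griesmer_bound (S := setT) dimV' (d := w1.+1).
rewrite cardsT card_ord => bound.
have {bound} : (griesmer_sum q (m + a + c) w1.+1 <= #|D| + #|D|)%N.
  by apply: bound => x xV xN; rewrite setIT; apply: wtV'.
move=> bound.
(* The Griesmer sum rises by at least a + b + c >= 3 from one below the length, and so exceeds the
   length. *)
have := griesmer_sum_dual_succ q_gt1 (m - b.+1) (a + b + c - 1).
rewrite -dimE -w1_dual_distance => /leq_trans/(_ bound).
rewrite -/(griesmer_sum _ _ _) [griesmer_sum _ _ _]code_near_griesmer.
by move: a_gt0 b_gt0 c_gt0; lia.
Qed.

(** The common factor (q - 1)q^(a+c-1) is divisible by q since a + c >= 2. For q = 2 the second
    factor 2 is explicit in w1 and w3, and in w2 it comes from 2 q^m - q^b with b >= 1. *)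
Lemma code_self_orthogonal : (q = 2 \/ q = 3)%N -> self_orthogonal code.
Proof.
have dvd_wt d x :
    (d %| w1 -> d %| w2 -> d %| w3 -> x \in code -> d %| wt x)%N.
  move=> d1 d2 d3 xV; have [-> | xN] := eqVneq x 0.
    by have /eqP-> : wt (0 : 'rV[F]_(#|D| + #|D|)) == 0%N by rewrite wt_eq0.
  by have := code_wt xV xN; rewrite !inE => /or3P[] /eqP ->.
have dvd_u : (q %| (q - 1) * q ^ (a + c - 1))%N.
  by rewrite dvdn_mull // dvdn_exp //; move: a_gt0 c_gt0; lia.
have dvd_qb : (q %| q ^ b)%N by rewrite dvdn_exp.
case=> qE.
  apply: self_orthogonal_binary => // x; apply: dvd_wt.
  - by rewrite w1E -[4%N]/(2 * 2)%N; apply: dvdn_mul; [rewrite -{1}qE | exact: dvdn_mulr].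
  - rewrite /w2 -[4%N]/(2 * 2)%N; apply: dvdn_mul; first by rewrite -{1}qE.
    by apply: dvdn_sub; [exact: dvdn_mulr | rewrite -{1}qE].
  - by rewrite w3E -[4%N]/(2 * 2)%N; apply: dvdn_mul; [rewrite -{1}qE | exact: dvdn_mulr].
by apply: self_orthogonal_ternary => // x; apply: dvd_wt;
  rewrite ?w1E ?w3E /w2 dvdn_mulr // -{1}qE.
Qed.

End Code.

Theorem mainTheorem7 (F : finFieldType) (m : nat) (A B C : {set 'I_m}) :
  (2 <= m)%N -> A != set0 -> B != set0 -> C != set0 ->
  (#|B| < m)%N -> ~~ (A \subset B) ->
  let q := #|F| in let a := #|A| in let b := #|B| in let c := #|C| in
  let ab := #|A :|: B| in
  let D := @S3 F m A B C in
  let w1 := (2 * (q - 1) * q ^ (a + c - 1) * (q ^ m - q ^ b))%N in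
  let w2 := ((q - 1) * q ^ (a + c - 1) * (2 * q ^ m - q ^ b))%N in
  let w3 := (2 * (q - 1) * q ^ (m + a + c - 1))%N in
  exists V : {vspace 'rV[F]_(#|D| + #|D|)},
    [/\ (forall x, (x \in V) = (x \in GrayCode D))
          /\ (#|D| + #|D| = 2 * q ^ (a + c) * (q ^ m - q ^ b))%N,
        is_code_kd V (m + a + c) w1,
        [/\ (forall x, x \in V -> x != 0 -> wt x \in [:: w1; w2; w3]),
            freq V w1 = (q ^ (m + a + c) - 2 * q ^ (m - b) + q ^ (m - ab))%N,
            freq V w2 = (2 * (q ^ (m - b) - q ^ (m - ab)))%N &
            freq V w3 = (q ^ (m - ab) - 1)%N],
        [/\ minimal_code V,
            near_griesmer F (#|D| + #|D|) (m + a + c) w1,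
            distance_optimal V (m + a + c) w1 &
            ((q = 2 \/ q = 3)%N -> self_orthogonal V)] &
        (A :|: B = setT -> size (weights V) = 2%N) /\
        (A :|: B != setT -> size (weights V) = 3%N)].
Proof.
move=> _ A0 B0 C0 Bm AB; exists (code F A B C); split.
- by split; [exact: mem_code_GrayCode | exact: length_code].
- exact: code_is_kd.
- split; [exact: code_wt | exact: freq_w1 | exact: freq_w2 | exact: freq_w3].
- split; [exact: code_minimal | exact: code_near_griesmer
         | exact: code_distance_optimal | exact: code_self_orthogonal].
- by rewrite size_weights //; split=> [-> | ->]; rewrite ?eqxx.
Qed.
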